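(* Let $\gamma$ be Euler's constant. As $n\to\infty$, $$\gamma=\frac{A_{n,2^{n+1}}-L_{n,2^{n+1}}}{2^{2^{n+1}}}+O(2^{-6\cdot 2^n}),\qquad \gamma=\frac{A_{n,2^{n}}-L_{n,2^{n}}}{2^{2^{n}}}+O\Big(\Big(\frac2{27}\Big)^{2^n}\Big),$$ $$\gamma=\frac{A_{n,2^{n-1}}-L_{n,2^{n-1}}}{2^{2^{n-1}}}+O\Big(\Big(\frac{128}{3125}\Big)^{2^{n-1}}\Big),\qquad \gamma=\frac12A_{n,1}-n\log2+O(2^{-n}).$$
   Context: For real $q>1$ the $q$-logarithm is $\ln_q(1+z)=\sum_{\mu=1}^\infty \frac{(-1)^{\mu-1}z^\mu}{q^\mu-1}$ for $|z|<q$. For integers $n\ge0$ and $0\le m\le 2^{n+1}$ define $$L_{n,m}=2^m n\log 2+\sum_{j=2}^m\binom mj\sum_{k=1}^{j-1}\frac{(-1)^{k-1}}k\ln_2\Big(1+\frac k{2^n}\Big),$$ $$A_{n,m}=\frac{2^m-1}{2^n}+2^m\sum_{\nu=1}^n\sum_{l=1}^{2^\nu-1}\frac{(-1)^{l-1}}l.$$ Empty sums are zero. *)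

(* Defs.v *)
(* MathComp-Analysis, over an arbitrary realType. *)
From mathcomp Require Import all_boot all_order all_algebra.
From mathcomp Require Import all_classical all_reals all_analysis.

Set Implicit Arguments.
Unset Strict Implicit.
Unset Printing Implicit Defensive.

Import Order.TTheory GRing.Theory Num.Theory.
Import numFieldNormedType.Exports.

Local Open Scope classical_set_scope.
Local Open Scope ring_scope.

Definition euler_gamma (R : realType) : R :=
  limn (fun n : nat => \sum_(1 <= k < n.+1) k%:R^-1 - ln (n%:R : R)).

(* The argument is x = 1 + z. The series converges for q > 1 and |x - 1| < q;
   where it diverges, limn returns an unspecified value. *)
Definition qln (R : realType) (q x : R) : R :=
  limn (fun n : nat =>
    \sum_(1 <= mu < n.+1) (-1) ^+ mu.-1 * (x - 1) ^+ mu / (q ^+ mu - 1)).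

(* For m <= 2 ^ n.+1, every value of qln below has z = k / 2 ^ n < 2. *)
Definition Lnm (R : realType) (n m : nat) : R :=
  2 ^+ m * n%:R * ln 2 +
  \sum_(2 <= j < m.+1) 'C(m, j)%:R *
    \sum_(1 <= k < j) (-1) ^+ k.-1 / k%:R * qln 2 (1 + k%:R / 2 ^+ n).

Definition Anm (R : realType) (n m : nat) : R :=
  (2 ^+ m - 1) / 2 ^+ n +
  2 ^+ m * \sum_(1 <= nu < n.+1) \sum_(1 <= l < (2 ^ nu)%N) (-1) ^+ l.-1 / l%:R.

(* Main.v *)
(** With N = 2^n, the sum in A_{n,m} telescopes to the harmonic number H_{N-1},
   because the alternating harmonic sum up to 2M - 1 equals H_{2M-1} - H_{M-1}.
   Put T(a) = \sum_{i >= 0} (-1)^i / (a + i) (= \int_0^1 x^(a-1) / (1 + x) dx). Then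
   gamma = H_{N-1} - n log 2 + \sum_{v > n} T(2^v). The functional equation
   ln_2(1 + z) = ln_2(1 + z/2) + (z/2) / (1 + z/2) gives
   ln_2(1 + k/N) / k = \sum_{v > n} 1 / (2^v + k). Substituting, everything cancels
   except an m-th finite difference:
     gamma - (A_{n,m} - L_{n,m}) / 2^m = 2^-m \sum_{v > n} (D^m T)(2^v),
   where D f a = f a - f (a + 1). Since T a + T (a + 1) = 1 / a and D^m (1 / a) =
   1 / (a * C(a + m, m)) is decreasing, 0 <= D^m T a <= 1 / (a * C(a + m, m)), so the
   error is at most 2^-m / (N * C(2N + m, m)). The factor 1 / N absorbs the polynomial
   loss in the exponential lower bounds of C(4N, 2N), C(3N, N) and C(5M, M), 2M = N. *)
Require Import Defs.
From mathcomp Require Import all_boot all_order all_algebra.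
From mathcomp Require Import all_classical all_reals all_analysis.
From mathcomp Require Import ring lra zify.
Import Order.TTheory GRing.Theory Num.Theory.
Import numFieldNormedType.Exports.
Local Open Scope classical_set_scope.
Local Open Scope ring_scope.

(** * Harmonic and alternating harmonic sums *)

Definition harm (R : realType) (a : nat) : R := \sum_(1 <= k < a) k%:R^-1.

Definition altharm (R : realType) (a : nat) : R :=
  \sum_(1 <= l < a) (-1) ^+ l.-1 / l%:R.

Lemma harmS (R : realType) a : (0 < a)%N -> harm R a.+1 = harm R a + a%:R^-1.
Proof. by move=> a0; rewrite /harm big_nat_recr. Qed.

Lemma altharmS (R : realType) a : (0 < a)%N ->
  altharm R a.+1 = altharm R a + (-1) ^+ a.-1 / a%:R.
Proof. by move=> a0; rewrite /altharm big_nat_recr. Qed.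

(** From M to M + 1 the left side gains 1/(2M+1) - 1/(2M+2), which equals 1/(2M+1) + 1/(2M+2) -
    1/(M+1). *)
Lemma altharm_odd (R : realType) M :
  altharm R M.*2.+1 = harm R M.*2.+1 - harm R M.+1.
Proof.
elim: M => [|M IHM]; first by rewrite subrr /altharm big_geq.
rewrite doubleS !(@altharmS _ _.+1) // !(@harmS _ _.+1) // IHM.
rewrite [(_.*2.+1).-1]/= [(_.*2.+2).-1]/= exprS -muln2 exprM sqrr_sign mulr1.
have : 0 <= M%:R :> R by [].
by rewrite -!natr1 natrM; move: M%:R => x x0; field; lra.
Qed.

Lemma altharm_even (R : realType) M : (0 < M)%N ->
  altharm R M.*2 = harm R M.*2 - harm R M.
Proof.
case: M => // M _; have := @altharm_odd R M.+1.
rewrite !(@altharmS _ M.+1.*2) // !(@harmS _ M.+1.*2) // (@harmS _ M.+1) //.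
move/(canRL (addrK _)) => ->; rewrite doubleS /= exprS -muln2 exprM sqrr_sign.
have : 0 <= M%:R :> R by [].
by rewrite -!natr1 natrM; move: M%:R => x x0; field; lra.
Qed.

(** * Logarithms against harmonic sums, and the limit gamma *)

(** Both sides come from ln (1 + x) <= x, with x = 1/k above and x = -1/(k+1) below. *)
Lemma ln_step_bounds (R : realType) k : (0 < k)%N ->
  k.+1%:R^-1 <= ln (k.+1%:R : R) - ln k%:R <= k%:R^-1.
Proof.
move=> k0; have kp : 0 < k%:R :> R by rewrite ltr0n.
have k1p : 0 < k.+1%:R :> R by rewrite ltr0n.
rewrite -ln_div ?posrE //; apply/andP; split.
  rewrite -[leRHS]opprK lerNr -lnV ?posrE ?divr_gt0 // invf_div.
  have -> : k%:R / k.+1%:R = 1 + - k.+1%:R^-1 :> R.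
    by rewrite -[in LHS](addrK 1 k%:R) natr1; field; rewrite gt_eqF.
  by apply: le_ln1Dx; rewrite ltrN2 invf_lt1 // ltr1n.
have -> : k.+1%:R / k%:R = 1 + k%:R^-1 :> R by rewrite -natr1; field; rewrite gt_eqF.
by apply: le_ln1Dx; rewrite (lt_trans _ (_ : 0 < _)) ?invr_gt0.
Qed.

(** The one-step bounds add up over M <= k < K. This gives the convergence to gamma and, with K =
    2M, the enclosure of ln 2. *)
Lemma harm_ln_bounds (R : realType) M K : (0 < M <= K)%N ->
  harm R K.+1 - harm R M.+1 <= ln (K%:R : R) - ln M%:R <= harm R K - harm R M.
Proof.
move=> /andP[M0]; elim: K => [|K IHK]; first by case: M M0.
rewrite leq_eqVlt => /orP[/eqP ->|]; first by rewrite !subrr lexx.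
rewrite ltnS => MK; have K0 := leq_trans M0 MK.
have /andP[l1 l2] := IHK MK; have /andP[s1 s2] := @ln_step_bounds R K K0.
have e1 := @harmS R K K0; have e2 := @harmS R K.+1 isT.
move: s1 s2 e1 e2; move: (_^-1) (_^-1) => u v *.
by apply/andP; split; lra.
Qed.

Lemma cvg_euler_gamma (R : realType) :
  (fun n => \sum_(1 <= k < n.+1) k%:R^-1 - ln (n%:R : R)) @ \oo
    --> euler_gamma R.
Proof.
rewrite /euler_gamma; set u := (X in X @ \oo --> _).
(* The shift skips n = 0, where [ln] takes a default value; monotonicity starts at n = 1. *)
suff /cvg_ex[l ul] : cvgn [sequence u n.+1]_n.
  by apply: (cvgP l); rewrite -cvg_shiftS.
apply: nonincreasing_is_cvgn.
  move=> n m nm /=.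
  have /andP[+ _] := @harm_ln_bounds R n.+1 m.+1 nm.
  by rewrite /u -/(harm R _) -/(harm R _); lra.
exists 0 => _ [n _ <-] /=.
have /andP[_] := @harm_ln_bounds R 1 n.+1 isT.
have -> : harm R 1 = 0 by rewrite /harm big_geq.
have : 0 <= n.+1%:R^-1 :> R by [].
rewrite ln1 /u -/(harm R n.+2) (@harmS _ n.+1) //.
by move: (_^-1) => y; lra.
Qed.

Lemma ln2_altharm_bounds (R : realType) M : (0 < M)%N ->
  altharm R M.*2.+1 <= ln 2 <= altharm R M.*2.
Proof.
move=> M0; rewrite altharm_odd altharm_even //.
have -> : ln 2 = ln (M.*2%:R) - ln (M%:R) :> R.
  by rewrite -mul2n natrM lnM ?posrE ?ltr0n // addrK.
by apply: harm_ln_bounds; rewrite M0 -addnn leq_addr.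
Qed.

Lemma cvg_pow2 : (2 ^ p)%N @[p --> \oo] --> \oo.
Proof.
apply/cvgnyPge => A; near=> p.
apply: (leq_trans (ltnW (ltn_expl A (isT : 1 < 2)%N))); rewrite leq_exp2l //.
by near: p; exists A.
Unshelve. all: by end_near. Qed.

Lemma cvg_inv_pow2 (R : realType) : (2 ^- p : R) @[p --> \oo] --> 0.
Proof.
have -> : (fun p => 2 ^- p : R) = geometric 1 2^-1.
  by apply/funext => p; rewrite -exprVn /geometric /= mul1r.
by apply: cvg_geometric; rewrite ger0_norm ?invf_lt1 ?ltr1n.
Qed.

(** [harm] stops one term before the sum that defines gamma; the missing 2^-p tends to 0. *)
Lemma cvg_harm_pow2 (R : realType) :
  harm R (2 ^ p) - p%:R * ln 2 @[p --> \oo] --> euler_gamma R.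
Proof.
have e : (fun p => harm R (2 ^ p) - p%:R * ln 2) =
   (fun p => (\sum_(1 <= k < (2 ^ p).+1) k%:R^-1 - ln ((2 ^ p)%:R : R)) - 2 ^- p).
  apply/funext => p; rewrite -/(harm R _) harmS ?expn_gt0 // natrX lnXn //.
  by rewrite mulr_natl; ring.
rewrite e -[euler_gamma R]subr0; apply: cvgB; last exact: cvg_inv_pow2.
exact: (cvg_comp _ _ cvg_pow2 (@cvg_euler_gamma R)).
Qed.

(** * Iterated differences of 1/a and of the alternating tail *)

Definition stepdiff {R : realType} (f : nat -> R) (a : nat) : R := f a - f a.+1.

Lemma iter_diffE (R : realType) (f : nat -> R) m a :
  iter m (@stepdiff R) f a =
  \sum_(0 <= j < m.+1) 'C(m, j)%:R * ((-1) ^+ j * f (a + j)%N).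
Proof.
elim: m a => [|m IHm] a; first by rewrite big_nat1 bin0 expr0 !mul1r addn0.
rewrite iterS /stepdiff !IHm.
(* A zero term j = m + 1 pads the first sum, so that Pascal's rule applies term by term. *)
have -> : \sum_(0 <= j < m.+1) 'C(m, j)%:R * ((-1) ^+ j * f (a + j)%N) =
    \sum_(0 <= j < m.+2) 'C(m, j)%:R * ((-1) ^+ j * f (a + j)%N).
  by rewrite [RHS]big_nat_recr //= bin_small // mul0r addr0.
rewrite !(@big_nat_recl _ _ _ m.+1) // !bin0 -addrA; congr (_ + _).
rewrite -sumrB; apply: eq_bigr => j _.
by rewrite binS natrD exprS addSnnS; ring.
Qed.

(** The value is the Beta integral of x^(a-1) (1-x)^m over [0, 1], obtained here by induction. *)
Lemma iter_diff_inv (R : realType) m a : (0 < a)%N ->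
  iter m (@stepdiff R) (fun a => a%:R^-1) a = (a%:R * 'C(a + m, m)%:R)^-1.
Proof.
elim: m a => [|m IHm] a a0; first by rewrite bin0 mulr1.
rewrite iterS /stepdiff !IHm // addnS addSn.
(* Both binomials of the step are rational multiples of C(a+m, m), which reduces the claim to
   [field]. *)
have e1 : 'C((a + m).+1, m.+1)%:R * m.+1%:R =
    'C(a + m, m)%:R * (a + m).+1%:R :> R.
  by rewrite -!natrM [in LHS]mulnC -mul_bin_diag mulnC.
have e2 : 'C((a + m).+1, m)%:R * a.+1%:R = 'C(a + m, m)%:R * (a + m).+1%:R :> R.
  have := mul_bin_down (a + m).+1 m; rewrite -addSn addnK addSn /= => e.
  by rewrite -!natrM [in LHS]mulnC -e mulnC.
have C0 : 'C(a + m, m)%:R != 0 :> R by rewrite pnatr_eq0 -lt0n bin_gt0 leq_addl.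
have nz k : k.+1%:R != 0 :> R by rewrite pnatr_eq0.
have a0' : a%:R != 0 :> R by rewrite pnatr_eq0 -lt0n.
rewrite -(mulfK (nz m) 'C(_, m.+1)%:R) e1 -(mulfK (nz a) 'C(_.+1, m)%:R) e2.
have amE : (a + m).+1%:R = a%:R + m.+1%:R :> R by rewrite -natrD addnS.
have := nz (a + m)%N; rewrite amE; move: C0 a0' (nz a) (nz m).
move: 'C(_, _)%:R a%:R a.+1%:R m.+1%:R => c x y z c0 x0 y0 z0 xz0.
by field; rewrite z0 xz0 c0 x0.
Qed.

(* The tail \sum_(i >= 0) (-1)^i / (a + i), since altharm tends to ln 2. *)
Definition alt_tail (R : realType) a : R := (-1) ^+ a * (altharm R a - ln 2).

Lemma alt_tailD (R : realType) a : (0 < a)%N ->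
  alt_tail R a + alt_tail R a.+1 = a%:R^-1.
Proof.
case: a => // a _; rewrite /alt_tail (@altharmS _ a.+1) //= !exprS !mulN1r opprK.
have s1 : (-1) ^+ a * (-1) ^+ a = 1 :> R by rewrite -expr2 sqrr_sign.
by rewrite -[RHS]mul1r -[X in _ = X * _]s1; ring.
Qed.

Lemma alt_tail_ge0 (R : realType) a : (0 < a)%N -> 0 <= alt_tail R a.
Proof.
move=> a0; rewrite /alt_tail -{2}(odd_double_half a) -signr_odd.
have [oa|ea] := boolP (odd a).
  rewrite add1n expr1 mulN1r oppr_ge0 subr_le0.
  case: (posnP a./2) => [->|h0]; last by have /andP[] := @ln2_altharm_bounds R _ h0.
  by rewrite /altharm big_geq // ln_ge0 ?ler1n.
rewrite add0n expr0 mul1r subr_ge0.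
suff /(@ln2_altharm_bounds R)/andP[] : (0 < a./2)%N by [].
by rewrite half_gt0; case: a a0 ea => [|[]].
Qed.

Lemma cvg_iter_diff0 (R : realType) (f : nat -> R) m :
  f @ \oo --> 0 -> iter m (@stepdiff R) f @ \oo --> 0.
Proof.
move=> f0; elim: m => // m IHm; rewrite iterS -[0](subrr 0).
by apply: cvgB => //; rewrite (cvg_shiftS (iter m (@stepdiff R) f)).
Qed.

(** Consecutive tails are nonnegative with sum 1/a, so each is at most 1/a. *)
Lemma cvg_alt_tail (R : realType) : alt_tail R @ \oo --> 0.
Proof.
rewrite -cvg_shiftS; apply: (@squeeze_cvgr _ _ _ _ (fun=> 0) harmonic).
- near=> a; rewrite alt_tail_ge0 //= -alt_tailD // lerDl.
  exact: alt_tail_ge0.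
- exact: cvg_cst.
- exact: cvg_harmonic.
Unshelve. all: by end_near. Qed.

(** Along a, a + 2, a + 4, ... the values decrease to 0. Steps of two suit D^m T, because D^m T a -
    D^m T (a+2) = D^(m+1) (1/a) has a known sign. *)
Lemma ge0_of_nonincreasing_even (R : realType) (f : nat -> R) a :
  f @ \oo --> 0 -> (forall k, (a <= k)%N -> f k.+2 <= f k) -> 0 <= f a.
Proof.
move=> f0 fS.
have fk k : f (k.*2 + a)%N <= f a.
  by elim: k => // k; apply: le_trans; rewrite doubleS !addSn fS // leq_addl.
have f2 : f (k.*2 + a)%N @[k --> \oo] --> 0.
  apply: (cvg_comp (fun k => (k.*2 + a)%N) f _ f0).
  apply/cvgnyPge => A; near=> k.
  apply: (@leq_trans k); last by rewrite -addnn -addnA leq_addr.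
  by near: k; exists A.
by apply: (ler_cvg_to f2 (cvg_cst (f a))); near=> k; apply: fk.
Unshelve. all: by end_near. Qed.

Lemma iter_diff_alt_tailD (R : realType) m a : (0 < a)%N ->
  iter m (@stepdiff R) (alt_tail R) a + iter m (@stepdiff R) (alt_tail R) a.+1 =
  iter m (@stepdiff R) (fun a => a%:R^-1) a.
Proof.
elim: m a => [|m IHm] a a0; first exact: alt_tailD.
by rewrite !iterS /stepdiff -!IHm //; ring.
Qed.

(** Once all D^m T are nonnegative, D^m T a is at most D^m T a + D^m T (a+1) = D^m (1/a). *)
Lemma iter_diff_alt_tail_bounds (R : realType) m a : (0 < a)%N ->
  0 <= iter m (@stepdiff R) (alt_tail R) a <= (a%:R * 'C(a + m, m)%:R)^-1.
Proof.
have ge0 b : (0 < b)%N -> 0 <= iter m (@stepdiff R) (alt_tail R) b.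
  move=> b0; apply: ge0_of_nonincreasing_even.
    exact: cvg_iter_diff0 (@cvg_alt_tail R).
  move=> k bk; have k0 := leq_trans b0 bk; rewrite -subr_ge0.
  have -> : iter m (@stepdiff R) (alt_tail R) k - iter m (@stepdiff R) (alt_tail R) k.+2
      = iter m.+1 (@stepdiff R) (fun a => a%:R^-1) k.
    by rewrite iterS /stepdiff -!iter_diff_alt_tailD //; ring.
  by rewrite iter_diff_inv // invr_ge0 mulr_ge0.
move=> a0; rewrite ge0 //= -iter_diff_inv // -iter_diff_alt_tailD // lerDl.
exact: ge0.
Qed.

(** * The 2-logarithm as the series of z / (2^r + z) *)

Lemma sum_inv_pow2 (R : realType) n p :
  \sum_(1 <= r < p.+1) (2 ^- (n + r) : R) = 2 ^- n - 2 ^- (n + p).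
Proof.
elim: p => [|p IHp]; first by rewrite big_geq // addn0 subrr.
rewrite big_nat_recr //= IHp addnS !exprS invfM.
by move: (2 ^- _) (2 ^- _) => x y; field.
Qed.

Lemma alt_geometric_sum (R : realType) n (w : R) : 0 <= w ->
  \sum_(1 <= mu < n.+1) (-1) ^+ mu.-1 * w ^+ mu = w * (1 - (- w) ^+ n) / (1 + w).
Proof.
move=> w0; have w1 : 1 + w != 0 by rewrite gt_eqF // ltr_pwDl.
elim: n => [|n IHn]; first by rewrite big_geq // subrr mulr0 mul0r.
by rewrite big_nat_recr //= IHn (exprNn w n) (exprNn w n.+1) !exprS; field.
Qed.

Definition qln2_psum {R : realType} n (z : R) : R :=
  \sum_(1 <= mu < n.+1) (-1) ^+ mu.-1 * z ^+ mu / (2 ^+ mu - 1).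

(** The functional equation at the level of partial sums, from 1/(Q-1) = 1/Q + 1/(Q(Q-1)) with Q =
    2^mu. *)
Lemma qln2_psum_half (R : realType) n (z : R) :
  qln2_psum n z =
  qln2_psum n (z / 2) + \sum_(1 <= mu < n.+1) (-1) ^+ mu.-1 * (z / 2) ^+ mu.
Proof.
rewrite /qln2_psum -big_split /=; apply: eq_big_nat => mu /andP[mu0 _].
have p1 : 1 < 2 ^+ mu :> R by rewrite exprn_egt1 ?ltr1n // -lt0n.
have p0 : 2 ^+ mu != 0 :> R by rewrite expf_neq0.
have p2 : 2 ^+ mu - 1 != 0 :> R by rewrite subr_eq0 gt_eqF.
by rewrite expr_div_n; field; rewrite p0 p2.
Qed.

(** The factor n is harmless: n stays fixed while w = z / 2^(p+1) tends to 0. *)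
Lemma qln2_psum_small (R : realType) n (w : R) : 0 <= w <= 1 ->
  `|qln2_psum n w| <= n%:R * w.
Proof.
move=> /andP[w0 w1]; apply: (le_trans (ler_norm_sum _ _ _)).
have -> : n%:R * w = \sum_(1 <= mu < n.+1) w.
  by rewrite sumr_const_nat subn1 mulr_natl.
apply: ler_sum_nat => mu /andP[mu0 _].
have p1 : 1 <= 2 ^+ mu - 1 :> R.
  rewrite lerBrDr (_ : 1 + 1 = 2 ^+ 1 :> R); last by rewrite expr1; lra.
  by rewrite ler_eXn2l ?ltr1n.
have p0 : 0 < 2 ^+ mu - 1 :> R by exact: lt_le_trans p1.
rewrite !normrM normfV normrX normrN1 expr1n mul1r !ger0_norm ?exprn_ge0 ?(ltW p0) //.
rewrite ler_pdivrMr //; apply: (@le_trans _ _ w).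
  by case: mu mu0 {p0 p1} => // mu _; rewrite exprS ler_piMr // exprn_ile1.
by rewrite ler_peMr.
Qed.

(* For fixed n, p -> oo makes the first error term vanish; then n -> oo. *)
Lemma qln2_psum_near (R : realType) n p (z : R) : 0 <= z < 2 ->
  `|qln2_psum n z - \sum_(1 <= r < p.+2) z / (2 ^+ r + z)|
    <= n%:R * z * 2 ^- p.+1 + z * (z / 2) ^+ n.
Proof.
move=> /andP[z0 z2].
(* After q halvings, the r-th one leaves a geometric sum in -z/2^r, whose main part is z / (2^r +
   z). *)
have unfold q : qln2_psum n z = qln2_psum n (z / 2 ^+ q) +
    \sum_(1 <= r < q.+1) z / (2 ^+ r + z) * (1 - (- (z / 2 ^+ r)) ^+ n).
  elim: q => [|q IHq]; first by rewrite big_geq // addr0 expr0 divr1.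
  rewrite IHq qln2_psum_half [in RHS]big_nat_recr //= addrAC -!addrA; congr (_ + _).
    by rewrite exprSr invfM mulrA.
  congr (_ + _); rewrite -mulrA -invfM -exprSr alt_geometric_sum; last first.
    by rewrite divr_ge0 ?exprn_ge0.
  have q0 : 0 < 2 ^+ q.+1 :> R by rewrite exprn_gt0.
  move: (_ ^+ n) q0 => y; move: (2 ^+ q.+1) => x x0.
  field; rewrite !gt_eqF //; lra.
rewrite (unfold p.+1) -addrA -sumrB; apply: (le_trans (ler_normD _ _)).
apply: lerD.
  rewrite -mulrA; apply: qln2_psum_small; rewrite divr_ge0 ?exprn_ge0 //=.
  rewrite ler_pdivrMr ?exprn_gt0 // mul1r (le_trans (ltW z2)) //.
  by rewrite -[leLHS]expr1 ler_eXn2l ?ltr1n.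
apply: (le_trans (ler_norm_sum _ _ _)).
(* As r >= 1, (z/2^r)^n <= (z/2)^n; the remaining factors 2^-r add up to at most 1. *)
apply: (@le_trans _ _ (\sum_(1 <= r < p.+2) z * (z / 2) ^+ n * 2 ^- (0 + r))).
  apply: ler_sum_nat => r /andP[r0 _].
  have r2 : 2 <= 2 ^+ r :> R by rewrite -[leLHS]expr1 ler_eXn2l ?ltr1n.
  have -> : z / (2 ^+ r + z) * (1 - (- (z / 2 ^+ r)) ^+ n) - z / (2 ^+ r + z)
      = - (z / (2 ^+ r + z) * (- (z / 2 ^+ r)) ^+ n) by ring.
  rewrite normrN normrM normrX normrN !ger0_norm ?divr_ge0 ?addr_ge0 ?exprn_ge0 //.
  rewrite [leRHS]mulrAC; apply: ler_pM.
  - by rewrite divr_ge0 ?addr_ge0 ?exprn_ge0.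
  - by rewrite exprn_ge0 ?divr_ge0 ?exprn_ge0.
  - by rewrite add0n ler_wpM2l // lef_pV2 ?posrE; lra.
  - by apply: lerXn2r; rewrite ?nnegrE ?divr_ge0 ?exprn_ge0 //
      ler_wpM2l // lef_pV2 ?posrE; lra.
rewrite -mulr_sumr sum_inv_pow2 expr0 invr1 ler_piMr ?mulr_ge0 ?exprn_ge0 ?divr_ge0 //.
Qed.

(** The series in r is monotone and bounded by z, hence has a limit l; the partial sums of the
    q-logarithm lie within z (z/2)^n of l, and z < 2 makes this vanish. *)
Lemma cvg_qln2 (R : realType) (z : R) : 0 <= z < 2 ->
  \sum_(1 <= r < p.+1) z / (2 ^+ r + z) @[p --> \oo] --> qln 2 (1 + z).
Proof.
move=> /andP[z0 z2]; set S := fun p => _.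
have pos r : 0 < 2 ^+ r + z by rewrite ltr_pwDl ?exprn_gt0.
have /cvg_ex[l Sl] : cvgn S.
  apply: nondecreasing_is_cvgn.
    apply/nondecreasing_seqP => p; rewrite /S [leRHS]big_nat_recr //= lerDl.
    by rewrite divr_ge0 // ltW.
  exists z => _ [p _ <-]; apply: (@le_trans _ _ (\sum_(1 <= r < p.+1) z * 2 ^- (0 + r))).
    apply: ler_sum_nat => r _; rewrite ler_wpM2l // lef_pV2 ?posrE ?exprn_gt0 //.
    by rewrite lerDl.
  by rewrite -mulr_sumr sum_inv_pow2 expr0 invr1 ler_piMr // gerBl invr_ge0 exprn_ge0.
have near_l n : `|qln2_psum n z - l| <= z * (z / 2) ^+ n.
  have S1 : S p.+1 @[p --> \oo] --> l by rewrite (cvg_shiftS S).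
  have c1 : `|qln2_psum n z - S p.+1| @[p --> \oo] --> `|qln2_psum n z - l|.
    by apply: cvg_norm; apply: cvgB => //; exact: cvg_cst.
  have c2 : n%:R * z * 2 ^- p.+1 + z * (z / 2) ^+ n @[p --> \oo]
      --> z * (z / 2) ^+ n.
    rewrite -[X in _ --> X]add0r; apply: cvgD; last exact: cvg_cst.
    rewrite -(mulr0 (n%:R * z)); apply: cvgM; first exact: cvg_cst.
    by rewrite (cvg_shiftS (fun p => 2 ^- p : R)); exact: cvg_inv_pow2.
  by apply: (ler_cvg_to c1 c2); near=> p; rewrite qln2_psum_near ?z0.
suff -> : qln 2 (1 + z) = l by [].
rewrite /qln; apply: cvg_lim => //.
under eq_fun do rewrite [1 + z - 1]addrC addKr.
apply/subr_cvg0/norm_cvg0P.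
apply: (@squeeze_cvgr _ _ _ _ (fun=> 0) (geometric z (z / 2))).
- by near=> n; rewrite normr_ge0 /geometric /= near_l.
- exact: cvg_cst.
- by apply: cvg_geometric; rewrite ger0_norm ?divr_ge0 //; lra.
Unshelve. all: by end_near. Qed.

(** * The remainder as a series of m-th differences *)

(** Telescoping: 1/(a+k) = T (a+k) + T (a+k+1). *)
Lemma alt_tail_psum (R : realType) a j : (0 < j)%N ->
  \sum_(1 <= k < j) (-1) ^+ k.-1 / (a + k)%:R =
  alt_tail R a.+1 + (-1) ^+ j * alt_tail R (a + j)%N.
Proof.
case: j => // j _; elim: j => [|j IHj].
  by rewrite big_geq // addn1 expr1 mulN1r subrr.
rewrite big_nat_recr //= IHj -alt_tailD ?addn_gt0 ?orbT // !addnS.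
by rewrite !exprS; ring.
Qed.

Lemma sum_bin (R : realType) m :
  \sum_(0 <= j < m.+1) 'C(m, j)%:R = 2 ^+ m :> R.
Proof.
rewrite -[2]/(1 + 1) exprDn big_mkord; apply: eq_bigr => j _.
by rewrite !expr1n mulr1.
Qed.

(** This form displays the double sum of L_{n,m}: summing 1/(a+k) over a = 2^v, v > n, produces
    ln_2(1 + k/2^n) / k. *)
Lemma iter_diff_alt_tailE (R : realType) m a : (0 < a)%N ->
  iter m stepdiff (alt_tail R) a =
  2 ^+ m * alt_tail R a - (2 ^+ m - 1) * a%:R^-1 +
  \sum_(2 <= j < m.+1) 'C(m, j)%:R *
    \sum_(1 <= k < j) (-1) ^+ k.-1 / (a + k)%:R.
Proof.
move=> a0; rewrite iter_diffE.
have T1 := @alt_tailD R a a0; set y := a%:R^-1 in T1 *.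
(* With T a - 1/a subtracted from (-1)^j T (a+j), there remains 1/a for j = 0, nothing for j = 1,
   and the inner sum for j >= 2. *)
suff e : \sum_(0 <= j < m.+1) ('C(m, j)%:R * ((-1) ^+ j * alt_tail R (a + j)%N)
      - 'C(m, j)%:R * (alt_tail R a - y)) =
    y + \sum_(2 <= j < m.+1) 'C(m, j)%:R *
      \sum_(1 <= k < j) (-1) ^+ k.-1 / (a + k)%:R.
  by move: e; rewrite sumrB -mulr_suml sum_bin; move/(canRL (subrK _)) => ->; ring.
rewrite big_ltn // addn0 bin0 expr0 !mul1r subKr; congr (_ + _).
case: m => [|m]; first by rewrite !big_geq.
rewrite big_ltn // addn1 expr1 -mulrBr.
have -> : -1 * alt_tail R a.+1 - (alt_tail R a - y) = 0 by rewrite -T1; ring.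
rewrite mulr0 add0r; apply: eq_big_nat => j /andP[j2 _].
by rewrite alt_tail_psum ?(ltnW j2) // -T1; ring.
Qed.

Lemma AnmE (R : realType) n m :
  Anm R n m = (2 ^+ m - 1) / 2 ^+ n + 2 ^+ m * harm R (2 ^ n).
Proof.
rewrite /Anm; congr (_ + _ * _); elim: n => [|n IHn].
  by rewrite /harm !big_geq.
rewrite big_nat_recr //= IHn -/(altharm R (2 ^ n.+1)).
by rewrite expnS mul2n altharm_even ?expn_gt0 // addrC subrK.
Qed.

(** For even 2^v, v >= 1, T (2^v) is H_{2^v-1} - H_{2^(v-1)-1} - ln 2, so the sum telescopes. *)
Lemma alt_tail_pow2_sum (R : realType) n p :
  \sum_(1 <= r < p.+1) alt_tail R (2 ^ (n + r))%N =
  harm R (2 ^ (n + p)) - (n + p)%:R * ln 2 - (harm R (2 ^ n) - n%:R * ln 2).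
Proof.
elim: p => [|p IHp]; first by rewrite big_geq // addn0 subrr.
rewrite big_nat_recr //= IHp addnS expnS mul2n /alt_tail -muln2 exprM sqrr_sign.
rewrite muln2 mul1r altharm_even ?expn_gt0 // -natr1; ring.
Qed.

Lemma cvg_sum_nat (R : realType) a b (f : nat -> nat -> R) (l : nat -> R) :
  (forall k, (a <= k < b)%N -> f k @ \oo --> l k) ->
  \sum_(a <= k < b) f k p @[p --> \oo] --> \sum_(a <= k < b) l k.
Proof.
move=> fl; rewrite big_nat_cond; under eq_fun do rewrite big_nat_cond.
by apply: cvg_big => [|k /andP[/fl]//]; exact: add_continuous.
Qed.

(** The series for ln_2 at z = k/2^n, divided by k; k < 2^(n+1) says z < 2. *)
Lemma cvg_sum_inv_qln2 (R : realType) n k : (0 < k < 2 ^ n.+1)%N ->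
  \sum_(1 <= r < p.+1) ((2 ^ (n + r) + k)%N%:R^-1 : R) @[p --> \oo]
    --> k%:R^-1 * qln 2 (1 + k%:R / 2 ^+ n : R).
Proof.
move=> /andP[k0 kn]; have n0 : 0 < 2 ^+ n :> R by rewrite exprn_gt0.
have k0' : 0 < k%:R :> R by rewrite ltr0n.
have z02 : 0 <= (k%:R / 2 ^+ n : R) < 2.
  rewrite divr_ge0 ?ltW //= ltr_pdivrMr // -exprS.
  by rewrite -natrX ltr_nat.
have /(cvgM (cvg_cst (k%:R^-1 : R))) := @cvg_qln2 R _ z02.
apply: cvg_trans; apply: near_eq_cvg; near=> p.
rewrite /= mulr_sumr; apply: eq_big_nat => r _.
rewrite natrD natrX exprD; have r0 : 0 < 2 ^+ r :> R by rewrite exprn_gt0.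
move: (2 ^+ n) (2 ^+ r) k%:R n0 r0 k0' => x y z x0 y0 z0.
have := mulr_gt0 x0 y0 => xy; field.
by rewrite !gt_eqF // addr_gt0.
Unshelve. all: by end_near. Qed.

Lemma cvg_remainder (R : realType) n m : (m <= 2 ^ n.+1)%N ->
  \sum_(1 <= r < p.+1) iter m stepdiff (alt_tail R) (2 ^ (n + r))%N @[p --> \oo]
    --> 2 ^+ m * euler_gamma R - (Anm R n m - Lnm R n m).
Proof.
move=> mn.
(* The limit is put in the shape of the finite sums below; the 0 is the limit of 2^-(n+p). *)
have -> : 2 ^+ m * euler_gamma R - (Anm R n m - Lnm R n m) =
    2 ^+ m * (euler_gamma R - (harm R (2 ^ n) - n%:R * ln 2)) -
    (2 ^+ m - 1) * (2 ^- n - 0) +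
    \sum_(2 <= j < m.+1) 'C(m, j)%:R * \sum_(1 <= k < j) (-1) ^+ k.-1 *
      (k%:R^-1 * qln 2 (1 + k%:R / 2 ^+ n)).
  rewrite AnmE /Lnm; under [in RHS]eq_bigr do under eq_bigr do rewrite mulrA.
  by move: (\sum_(_ <= _ < _) _) => s; ring.
have -> : (fun p => \sum_(1 <= r < p.+1) iter m stepdiff (alt_tail R) (2 ^ (n + r))%N) =
    (fun p => 2 ^+ m * (harm R (2 ^ (n + p)) - (n + p)%:R * ln 2
                        - (harm R (2 ^ n) - n%:R * ln 2)) -
      (2 ^+ m - 1) * (2 ^- n - 2 ^- (n + p)) +
      \sum_(2 <= j < m.+1) 'C(m, j)%:R * \sum_(1 <= k < j) (-1) ^+ k.-1 *
        \sum_(1 <= r < p.+1) (2 ^ (n + r) + k)%N%:R^-1).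
  apply/funext => p; rewrite -alt_tail_pow2_sum -sum_inv_pow2 !mulr_sumr -sumrB.
  under eq_bigr do rewrite iter_diff_alt_tailE ?expn_gt0 //.
  rewrite big_split /=; congr (_ + _).
    by apply: eq_bigr => r _; rewrite natrX.
  rewrite exchange_big; apply: eq_bigr => j _; rewrite -mulr_sumr; congr (_ * _).
  by rewrite exchange_big; apply: eq_bigr => k _; rewrite -mulr_sumr.
have cn : (n + p)%N @[p --> \oo] --> \oo by exact: cvg_addnl.
apply: cvgD; first apply: cvgB; first apply: cvgM; first exact: cvg_cst.
- apply: cvgB; last exact: cvg_cst.
  exact: (cvg_comp _ _ cn (@cvg_harm_pow2 R)).
- apply: cvgM; first exact: cvg_cst.
  apply: cvgB; first exact: cvg_cst.
  exact: (cvg_comp _ _ cn (@cvg_inv_pow2 R)).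
apply: cvg_sum_nat => j /andP[j2 jm]; apply: cvgM; first exact: cvg_cst.
apply: cvg_sum_nat => k /andP[k1 kj]; apply: cvgM; first exact: cvg_cst.
(* k < j <= m <= 2^(n+1) keeps k/2^n below 2. *)
by apply: cvg_sum_inv_qln2; rewrite k1 (leq_trans kj) // (leq_trans _ mn).
Qed.

Lemma euler_gamma_remainder (R : realType) n m : (m <= 2 ^ n.+1)%N ->
  0 <= 2 ^+ m * euler_gamma R - (Anm R n m - Lnm R n m)
    <= (2 ^+ n * 'C(2 ^ n.+1 + m, m)%:R)^-1.
Proof.
move=> /(@cvg_remainder R); set u := (X in X @ \oo --> _) => ul.
have a0 r : (0 < 2 ^ (n + r))%N by rewrite expn_gt0.
apply/andP; split.
  apply: (ler_cvg_to (cvg_cst 0) ul); near=> p; apply: sumr_ge0 => r _.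
  by have /andP[] := @iter_diff_alt_tail_bounds R m _ (a0 r).
apply: (ler_cvg_to ul (cvg_cst _)); near=> p.
set C := 'C(_, _)%:R; have C0 : 0 < C by rewrite ltr0n bin_gt0 leq_addl.
(* C(a+m, m) grows with a, so its value at r = 1 serves every r; only 2^-(n+r) is summed. *)
apply: (@le_trans _ _ (\sum_(1 <= r < p.+1) C^-1 * 2 ^- (n + r))).
  apply: ler_sum_nat => r /andP[r1 _].
  have /andP[_ /le_trans] := @iter_diff_alt_tail_bounds R m _ (a0 r); apply.
  rewrite invfM mulrC natrX ler_wpM2r ?invr_ge0 ?exprn_ge0 //.
  rewrite lef_pV2 ?posrE ?ltr0n ?bin_gt0 ?leq_addl // ler_nat.
  by apply: leq_bin2l; rewrite leq_add2r leq_exp2l // -addn1 leq_add2l.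
rewrite -mulr_sumr sum_inv_pow2 invfM mulrC ler_wpM2r ?invr_ge0 ?(ltW C0) //.
by rewrite gerBl invr_ge0 exprn_ge0.
Unshelve. all: by end_near. Qed.

(** * Exponential lower bounds for binomials *)

Lemma bin_factR (R : realType) a b :
  'C(a + b, a)%:R * a`!%:R * b`!%:R = (a + b)`!%:R :> R.
Proof. by rewrite -!natrM -mulnA -{2}(addKn a b) bin_fact ?leq_addr. Qed.

Lemma factSR (R : realType) n : n.+1`!%:R = (n%:R + 1) * n`!%:R :> R.
Proof. by rewrite factS natrM natr1. Qed.

(** k C(2k, k) grows by the factor 2(2k+1)/k >= 4 at each step, with equality in the bound at k = 1.
    The next two lemmas use the same ratio argument, with rates 27/4 = 3^3/2^2 and 3125/256 =
    5^5/4^4. *)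
Lemma bin_double_growth (R : realType) k : (0 < k)%N ->
  4 ^+ k <= 2 * k%:R * 'C(k + k, k)%:R :> R.
Proof.
elim: k => // k IHk _; case: (posnP k) => [->|k0].
  by rewrite expr1 (_ : 'C(1 + 1, 1) = 2)%N //; lra.
have F0 : k`!%:R * k`!%:R != 0 :> R by rewrite mulf_neq0 ?pnatr_eq0 -?lt0n ?fact_gt0.
have x0 : 0 < k%:R :> R by rewrite ltr0n.
have e := @bin_factR R k k; have := @bin_factR R k.+1 k.+1.
have -> : (k.+1 + k.+1)`! = (k + k).+2`! by rewrite addSn addnS.
rewrite !factSR -[k.+1%:R]natr1 -[(k + k).+1%:R]natr1 natrD -e exprS => e'.
have c0 : 0 <= 'C(k + k, k)%:R :> R by [].
move: (IHk k0) F0 x0 c0 e'; move: 'C(k + k, k)%:R 'C(k.+1 + k.+1, k.+1)%:R => c c'.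
move: (4 ^+ k) k`!%:R k%:R => y F x IH F0 x0 c0 e'.
have e2 : c' * (x + 1) * (x + 1) = (2 * x + 2) * (2 * x + 1) * c.
  by apply: (mulIf F0); move: e' => /eqP; rewrite -subr_eq0 => /eqP e'; lra.
have e3 : c' * (x + 1) = 2 * (2 * x + 1) * c.
  by apply: (mulIf (_ : x + 1 != 0)); [rewrite gt_eqF //; lra | rewrite e2; ring].
lra.
Qed.

Lemma bin_triple_growth (R : realType) k : (0 < k)%N ->
  (27 / 4) ^+ k <= 4 * k%:R * 'C(k + 2 * k, k)%:R :> R.
Proof.
elim: k => // k IHk _; case: (posnP k) => [->|k0].
  by rewrite expr1 (_ : 'C(1 + 2 * 1, 1) = 3)%N //; lra.
have F0 : k`!%:R * (2 * k)`!%:R != 0 :> R.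
  by rewrite mulf_neq0 ?pnatr_eq0 -?lt0n ?fact_gt0.
have x0 : 0 < k%:R :> R by rewrite ltr0n.
have e := @bin_factR R k (2 * k); have := @bin_factR R k.+1 (2 * k.+1).
have -> : (k.+1 + 2 * k.+1)`! = (k + 2 * k).+3`! by congr _`!; lia.
have -> : (2 * k.+1)`! = (2 * k).+2`! by congr _`!; lia.
rewrite !factSR -[k.+1%:R]natr1 -[(k + 2 * k).+2%:R]natr1 -[(k + 2 * k).+1%:R]natr1.
rewrite -[(2 * k).+1%:R]natr1 [(k + 2 * k)%:R]natrD [(2 * k)%:R]natrM -e exprS => e'.
have c0 : 0 <= 'C(k + 2 * k, k)%:R :> R by [].
move: (IHk k0) F0 x0 c0 e'.
move: 'C(k + 2 * k, k)%:R 'C(k.+1 + 2 * k.+1, k.+1)%:R => c c'.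
move: (_ ^+ k) k`!%:R (2 * k)`!%:R k%:R => y F G x IH F0 x0 c0 e'.
have e2 : c' * (x + 1) * ((2 * x + 2) * (2 * x + 1)) =
    (3 * x + 3) * (3 * x + 2) * (3 * x + 1) * c.
  by apply: (mulIf F0); move: e' => /eqP; rewrite -subr_eq0 => /eqP e'; lra.
have z0 : 0 < (2 * x + 2) * (2 * x + 1) by rewrite mulr_gt0; lra.
rewrite -(ler_pM2r z0).
have -> : 4 * (x + 1) * c' * ((2 * x + 2) * (2 * x + 1)) =
    4 * (3 * x + 3) * (3 * x + 2) * (3 * x + 1) * c by lra.
apply: (@le_trans _ _ (27 * x * c * ((2 * x + 2) * (2 * x + 1)))); nra.
Qed.

Lemma bin_quintuple_growth (R : realType) k : (0 < k)%N ->
  (3125 / 256) ^+ k <= 4 * k%:R * 'C(k + 4 * k, k)%:R :> R.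
Proof.
elim: k => // k IHk _; case: (posnP k) => [->|k0].
  by rewrite expr1 (_ : 'C(1 + 4 * 1, 1) = 5)%N //; lra.
have F0 : k`!%:R * (4 * k)`!%:R != 0 :> R.
  by rewrite mulf_neq0 ?pnatr_eq0 -?lt0n ?fact_gt0.
have x0 : 0 < k%:R :> R by rewrite ltr0n.
have e := @bin_factR R k (4 * k); have := @bin_factR R k.+1 (4 * k.+1).
have -> : (k.+1 + 4 * k.+1)`! = (k + 4 * k).+4.+1`! by congr _`!; lia.
have -> : (4 * k.+1)`! = (4 * k).+4`! by congr _`!; lia.
rewrite !factSR -[k.+1%:R]natr1 -[(k + 4 * k).+4%:R]natr1 -[(k + 4 * k).+3%:R]natr1.
rewrite -[(k + 4 * k).+2%:R]natr1 -[(k + 4 * k).+1%:R]natr1.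
rewrite -[(4 * k).+3%:R]natr1 -[(4 * k).+2%:R]natr1 -[(4 * k).+1%:R]natr1.
rewrite [(k + 4 * k)%:R]natrD [(4 * k)%:R]natrM -e exprS => e'.
have c0 : 0 <= 'C(k + 4 * k, k)%:R :> R by [].
move: (IHk k0) F0 x0 c0 e'.
move: 'C(k + 4 * k, k)%:R 'C(k.+1 + 4 * k.+1, k.+1)%:R => c c'.
move: (_ ^+ k) k`!%:R (4 * k)`!%:R k%:R => y F G x IH F0 x0 c0 e'.
set z := (4 * x + 4) * (4 * x + 3) * (4 * x + 2) * (4 * x + 1).
set w := (5 * x + 5) * (5 * x + 4) * (5 * x + 3) * (5 * x + 2) * (5 * x + 1).
have e2 : c' * (x + 1) * z = w * c.
  apply: (mulIf F0); move: e' => /eqP; rewrite -subr_eq0 => /eqP e'.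
  by rewrite /z /w; lra.
have z0 : 0 < z by rewrite /z !mulr_gt0 // addr_gt0 // mulr_gt0.
have zw : 3125 / 256 * x * z <= w.
  (* Factorwise comparison: (5/4)(4x+i) <= 5x+i+1 for i = 1, 2, 3, with equality between (5/4)(4x+4)
     and 5x+5. *)
  have -> : 3125 / 256 * x * z = 5 / 4 * (4 * x + 4) * (5 / 4 * (4 * x + 3)) *
      (5 / 4 * (4 * x + 2)) * (5 / 4 * (4 * x + 1)) * (5 * x).
    rewrite (_ : 3125 / 256 = (5 / 4) ^+ 4 * 5); first by rewrite /z; ring.
    by rewrite expr_div_n -!natrX mulrAC -natrM; congr (_%:R / _%:R).
  have x0' := ltW x0.
  by rewrite !ler_pM ?mulr_ge0 ?addr_ge0 ?mulr_ge0 ?divr_ge0 //; lra.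
have : 0 <= 3125 / 256 :> R := divr_ge0 (ler0n _ _) (ler0n _ _).
clearbody z w; move: (3125 / 256) zw => q zw q0; rewrite -(ler_pM2r z0).
have -> : 4 * (x + 1) * c' * z = w * (4 * c).
  by rewrite mulrCA -e2; ring.
apply: (@le_trans _ _ (q * (4 * x * c) * z)).
  by apply: ler_wpM2r; [exact: ltW | exact: ler_wpM2l].
have -> : q * (4 * x * c) * z = q * x * z * (4 * c) by ring.
by apply: ler_wpM2r => //; apply: mulr_ge0.
Qed.

(** * Error bounds and the four asymptotics *)

Lemma euler_gamma_error (R : realType) n m : (m <= 2 ^ n.+1)%N ->
  `|euler_gamma R - (Anm R n m - Lnm R n m) / 2 ^+ m|
    <= (2 ^+ m * 2 ^+ n * 'C(2 ^ n.+1 + m, m)%:R)^-1.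
Proof.
move=> /(@euler_gamma_remainder R)/andP[r0 r1].
have p0 : 0 < 2 ^+ m :> R by rewrite exprn_gt0.
have -> : euler_gamma R - (Anm R n m - Lnm R n m) / 2 ^+ m =
    (2 ^+ m * euler_gamma R - (Anm R n m - Lnm R n m)) / 2 ^+ m.
  by move: p0; move: (2 ^+ m) => x x0; field; rewrite gt_eqF.
rewrite ger0_norm; last by rewrite mulr_ge0 // invr_ge0 ltW.
by rewrite -mulrA invfM mulrC ler_wpM2l // invr_ge0 ltW.
Qed.

(** Used with p = 2^m, q = 2^n, c the binomial and g its exponential rate: q absorbs the linear
    factor of the growth bounds. *)
Lemma inv_prod_le (R : realType) (p q c g : R) : 0 < p -> 0 < g ->
  g <= 4 * (q * c) -> (p * q * c)^-1 <= 4 * (p * g)^-1.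
Proof.
move=> p0 g0 gqc; have qc0 : 0 < q * c by lra.
rewrite -mulrA !(invfM p) mulrCA ler_wpM2l ?invr_ge0 ?(ltW p0) //.
by rewrite ler_pdivlMr // mulrC ler_pdivrMr.
Qed.

(** Leaving out n = 0 avoids the truncated [n.-1], for which 2^(n-1) is not half of 2^n. *)
Lemma eqaddO_of_le (R : realType) (a : R) (f g : nat -> R) (c : R) :
  (forall n, (0 < n)%N -> `|a - f n| <= c * g n) -> (fun=> a) = f +O_\oo g.
Proof.
move=> fg; apply/eqaddOP; near=> k; exists 1%N => // n n1 /=.
apply: (le_trans (fg n n1)); apply: (le_trans (ler_norm _)); rewrite normrM.
by rewrite ler_wpM2r //; near: k; apply: nbhs_pinfty_ge; rewrite num_real.
Unshelve. all: by end_near. Qed.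

Theorem theorem4 (R : realType) :
  [/\ (fun=> euler_gamma R) =
        (fun n : nat => (Anm R n (2 ^ n.+1) - Lnm R n (2 ^ n.+1))
                        / 2 ^+ (2 ^ n.+1))
        +O_\oo (fun n : nat => 2 ^- (6 * 2 ^ n) : R),
      (fun=> euler_gamma R) =
        (fun n : nat => (Anm R n (2 ^ n) - Lnm R n (2 ^ n)) / 2 ^+ (2 ^ n))
        +O_\oo (fun n : nat => (2 / 27) ^+ (2 ^ n) : R),
      (fun=> euler_gamma R) =
        (fun n : nat => (Anm R n (2 ^ n.-1) - Lnm R n (2 ^ n.-1))
                        / 2 ^+ (2 ^ n.-1))
        +O_\oo (fun n : nat => (128 / 3125) ^+ (2 ^ n.-1) : R) &
      (fun=> euler_gamma R) =
        (fun n : nat => 2^-1 * Anm R n 1 - n%:R * ln 2)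
        +O_\oo (fun n : nat => 2 ^- n : R)].
Proof.
have p2 n : (0 < 2 ^ n)%N by rewrite expn_gt0.
(* The constant 4 covers all four cases; in the first it arises as 2k = 4 * 2^n with k = 2^(n+1). *)
split; apply: (@eqaddO_of_le _ _ _ _ 4) => n n0.
- apply: (le_trans (@euler_gamma_error R n _ (leqnn _))).
  (* With m = 2^(n+1), the error 2^-m / C(2m, m) has rate 2^-m 4^-m. *)
  have -> : (6 * 2 ^ n = 2 ^ n.+1 + 2 * 2 ^ n.+1)%N by rewrite expnS; lia.
  rewrite exprD exprM; apply: inv_prod_le; rewrite ?exprn_gt0 //.
  have -> : (2 ^+ 2 : R) = 4 by rewrite expr2; lra.
  apply: (le_trans (@bin_double_growth R _ (p2 n.+1))).
  by rewrite natrX exprS; lra.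
- apply: (le_trans (@euler_gamma_error R n (2 ^ n) _)); first by rewrite leq_exp2l.
  have -> : 2 / 27 = (2 * (27 / 4))^-1 :> R by field.
  rewrite exprVn exprMn; apply: inv_prod_le; rewrite ?exprn_gt0 ?divr_gt0 //.
  rewrite expnS addnC -natrX mulrA; exact: bin_triple_growth.
- case: n n0 => // n _ /=.
  apply: (le_trans (@euler_gamma_error R n.+1 (2 ^ n) _)).
    by rewrite leq_exp2l // ltnW.
  have s0 : 0 < 3125 / 256 :> R := divr_gt0 (ltr0Sn _ _) (ltr0Sn _ _).
  (* After the shift of n, m = 2^n and 2^(n+2) = 4m, so the binomial is C(5m, m). *)
  have -> : 128 / 3125 = (2 * (3125 / 256))^-1 :> R.
    by rewrite invfM invf_div mulrA; congr (_ * _); lra.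
  move: (3125 / 256) s0 (@bin_quintuple_growth R _ (p2 n)) => q q0 qle.
  rewrite exprVn exprMn; apply: inv_prod_le; rewrite ?exprn_gt0 //.
  apply: (le_trans qle); have -> : (2 ^ n.+2 + 2 ^ n = 2 ^ n + 4 * 2 ^ n)%N.
    by rewrite !expnS; lia.
  rewrite -mulrA ler_wpM2l // ler_wpM2r // natrX exprS.
  by rewrite ler_peMl ?exprn_ge0 ?ler1n.
have := @euler_gamma_error R n 1 (p2 n.+1).
(* For m = 1 the double sum in L is empty, and the binomial need only be at least 1. *)
rewrite expr1 /Lnm big_geq // addr0 expr1.
have -> : (Anm R n 1 - 2 * n%:R * ln 2) / 2 = 2^-1 * Anm R n 1 - n%:R * ln 2 by lra.
move=> /le_trans; apply; set c := 'C(_, _)%:R.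
have c1 : 1 <= c by rewrite ler1n bin1 addn1.
have y0 : 0 < 2 ^+ n :> R by rewrite exprn_gt0.
apply: (@le_trans _ _ (2 ^- n)).
  by rewrite lef_pV2 ?posrE ?mulr_gt0 ?(lt_le_trans _ c1) //; nra.
by rewrite ler_peMl ?ler1n // invr_ge0 ltW.
Qed.
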